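(* Let $G$ be a finite group and let $p$ be a prime. Then $\phi_p(G/Z(G)) \leq \epsilon_p(G)$.
   Context: $Z(G)$ is the center of $G$. For a finite group $H$, $\Phi(H)$ denotes the Frattini subgroup of $H$ (the intersection of all maximal subgroups of $H$). Put $\Phi_0(H)=H$ and $\Phi_m(H)=\Phi(\Phi_{m-1}(H))$ for every positive integer $m$. For a prime $p$, $\phi_p(H)$ is the least integer $m\geq 0$ such that $\Phi_m(P)=1$, where $P$ is a Sylow $p$-subgroup of $H$. For $x\in H$, $x^H$ denotes the conjugacy class of $x$ in $H$, and $\epsilon_p(x)$ is the exponent of the largest power of $p$ dividing $|x^H|=|H:C_H(x)|$. Finally, $\epsilon_p(H)=\max\{\epsilon_p(x): x\in H\}$. *)

(* Defs.v *)
From mathcomp Require Import all_boot all_fingroup all_solvable.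

Set Implicit Arguments.
Unset Strict Implicit.
Unset Printing Implicit Defensive.

Import GroupScope.

Definition Phi_iter (gT : finGroupType) (m : nat) (H : {group gT}) :
  {group gT} := iter m (fun K : {group gT} => 'Phi(K)%G) H.

Arguments Phi_iter {gT} m%_N H%_G.

Lemma Phi_iter_card (gT : finGroupType) (m : nat) (H : {group gT}) :
  #|Phi_iter m H| <= maxn 1 (#|H| - m).
Proof.
elim: m => [|m IHm] /=; first by rewrite subn0 leq_max leqnn orbT.
case: (eqVneq (Phi_iter m H : {set gT}) 1) => [K1 | ntK].
  have := subset_leq_card (Phi_sub (Phi_iter m H)).
  rewrite {2}K1 cards1 leq_max => le1; exact/orP/or_introl.
have ltK := proper_card (Phi_proper ntK).
have K_gt1 : 1 < #|Phi_iter m H| by rewrite cardG_gt1.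
move: IHm; rewrite leq_max leqNgt K_gt1 /= => IHm.
rewrite leq_max; apply/orP; right.
by rewrite subnS -ltnS; apply: leq_trans ltK (leq_trans IHm (leqSpred _)).
Qed.

Lemma Phi_iter_Sylow_trivial
    (gT : finGroupType) (p : nat) (H : {group gT}) :
  exists m, [forall (P : {group gT} | p.-Sylow(H) P), Phi_iter m P :==: 1].
Proof.
exists #|H|; apply/forall_inP => P /pHall_sub sPH.
rewrite -[_ :==: 1]/(_ == 1) trivg_card_le1.
apply: leq_trans (Phi_iter_card #|H| P) _.
by rewrite (eqP (subset_leq_card sPH : _ - _ == 0)) maxn0.
Qed.

(* The Sylow p-subgroups of H are conjugate, so requiring Phi_m(P) = 1 for
   all of them or for one of them amounts to the same (phi_lenP below). *)
Definition phi_len (gT : finGroupType) (p : nat) (H : {group gT}) : nat :=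
  ex_minn (Phi_iter_Sylow_trivial p H).

Arguments phi_len {gT} p%_N H%_G.

Lemma Phi_iterJ (gT : finGroupType) (m : nat) (H : {group gT}) (x : gT) :
  Phi_iter m (H :^ x) :=: Phi_iter m H :^ x.
Proof. by elim: m => //= m ->; rewrite PhiJ. Qed.

Lemma Phi_iter_trivial_leq (gT : finGroupType) (m n : nat) (H : {group gT}) :
  m <= n -> Phi_iter m H :=: 1 -> Phi_iter n H :=: 1.
Proof.
move=> le_mn Hm1; rewrite -(subnK le_mn); elim: (n - m) => //= k IHk.
by apply/trivgP; apply: subset_trans (Phi_sub _) _; rewrite IHk.
Qed.

Lemma phi_lenP (gT : finGroupType) (p m : nat) (H P : {group gT}) :
  p.-Sylow(H) P -> (phi_len p H <= m) = (Phi_iter m P :==: 1).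
Proof.
move=> sylP; rewrite /phi_len; case: ex_minnP => k /forall_inP Hk kmin.
apply/idP/eqP => [le_km | Pm1].
  exact: Phi_iter_trivial_leq le_km (eqP (Hk P sylP)).
apply: kmin; apply/forall_inP => Q sylQ.
have [x _ defQ] := Sylow_trans sylP sylQ.
have -> : Q = (P :^ x)%G by apply: group_inj.
by rewrite Phi_iterJ Pm1 conjs1g.
Qed.

Definition eps_elt (gT : finGroupType) (p : nat) (H : {group gT}) (x : gT) :
  nat := logn p #|x ^: H|.

Arguments eps_elt {gT} p%_N H%_G x%_g.

Definition eps (gT : finGroupType) (p : nat) (H : {group gT}) : nat :=
  \max_(x in H) eps_elt p H x.

Arguments eps {gT} p%_N H%_G.

(* Main.v *)
Require Import Defs.
From mathcomp Require Import all_boot all_fingroup all_solvable.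

(* Let P be a Sylow p-subgroup of G and m = eps p G. For x in G, a Sylow
   p-subgroup of 'C_G[x] is, up to conjugation, a subgroup of index at most
   p ^ m in P, hence contains Phi_iter m P: each step down a chain of maximal
   subgroups costs one Phi. So every element of G has a conjugate in
   C = 'C_G(Phi_iter m P). A finite group is not covered by the conjugates of
   a proper subgroup, so C = G, i.e., Phi_iter m P is central in G. *)

Set Implicit Arguments.
Unset Strict Implicit.
Unset Printing Implicit Defensive.

Import GroupScope.

Lemma Phi_iter_sub (gT : finGroupType) (m : nat) (H : {group gT}) :
  Phi_iter m H \subset H.
Proof. by elim: m => //= m; apply: subset_trans (Phi_sub _). Qed.

(** Iterates of [PhiS]: the Frattini subgroup is monotone on p-groups, though not on arbitrary
    finite groups. *)
Lemma Phi_iterS (gT : finGroupType) (p m : nat) (H P : {group gT}) :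
  p.-group P -> H \subset P -> Phi_iter m H \subset Phi_iter m P.
Proof.
move=> pP sHP; elim: m => //= m IHm.
exact: PhiS (pgroupS (Phi_iter_sub m P) pP) IHm.
Qed.

Lemma Phi_iter_sub_logn_index (gT : finGroupType) (p m : nat)
    (P Q : {group gT}) :
  p.-group P -> Q \subset P -> logn p #|P : Q| <= m -> Phi_iter m P \subset Q.
Proof.
elim: m P => [|m IHm] P pP sQP le_m;
  have [-> | [M maxM sQM]] := maximal_exists sQP; rewrite ?Phi_iter_sub //.
all: have sMP := proper_sub (maxgroupp maxM).
all: have iPM := p_maximal_index pP maxM.
all: have ntP : P :!=: 1.
1,3: by apply: contraTneq (maxgroupp maxM) => ->; rewrite properE sub1G andbF.
all: have [p_pr _ _] := pgroup_pdiv pP ntP.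
all: move: le_m; rewrite -(Lagrange_index sMP sQM) iPM.
(* As [M] has index [p], [le_m] loses one unit; for [m = 0] this is absurd. *)
all: rewrite lognM ?indexg_gt0 ?prime_gt0 // logn_prime // eqxx add1n ?ltn0 // => le_m.
(* The innermost ['Phi(P)] is peeled off: it lies in [M]. *)
rewrite /Phi_iter iterSr; apply: subset_trans (IHm M (pgroupS sMP pP) sQM le_m).
exact: Phi_iterS (pgroupS sMP pP) (Phi_sub_max maxM).
Qed.

(** At most [#|G : H|] conjugates of [H^#] cover at most [#|G| - #|G : H|] elements, but [G^#] has
    [#|G| - 1]. *)
Lemma class_support_eqG (gT : finGroupType) (G H : {group gT}) :
  H \subset G -> G \subset class_support H G -> H :=: G.
Proof.
move=> sHG sGH; apply/eqP; rewrite eqEsubset sHG -indexg_eq1.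
rewrite eqn_leq indexg_gt0 andbT.
have leG : #|G^#| <= #|G : H| * #|H^#|.
  apply: leq_trans (subset_leq_card (setSD _ sGH)) _.
  rewrite class_supportD1; apply: leq_trans (leq_card_cover _).1 _.
  apply: (@leq_trans (\sum_(A in H^# :^: G) #|H^#|)).
    by apply: leq_sum => A /imsetP[x _ ->]; rewrite cardJg.
  rewrite sum_nat_const leq_mul2r card_conjugates normD1; apply/orP; right.
  by rewrite dvdn_leq // indexgS // subsetI sHG normG.
have cardD1 (K : {group gT}) : #|K| = #|K^#|.+1 by rewrite (cardsD1 1) group1.
have := Lagrange sHG; rewrite mulnC (cardD1 H) (cardD1 G) mulnS => defG.
by rewrite -(leq_add2r (#|G : H| * #|H^#|)) defG add1n ltnS.
Qed.

Lemma Phi_iter_eps_central (gT : finGroupType) (G P : {group gT}) (p : nat) :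
  p.-Sylow(G) P -> Phi_iter (eps p G) P \subset 'Z(G).
Proof.
move=> sylP; have [sPG pP _] := and3P sylP; set K := Phi_iter _ P.
have sKG : K \subset G := subset_trans (Phi_iter_sub _ P) sPG.
suff /setIidPl defC : 'C_G(K) = G by rewrite subsetI sKG centsC.
apply: class_support_eqG (subsetIl _ _) _.
apply/subsetP => x Gx; have [Q sylQ] := Sylow_exists p 'C_G[x].
have [sQC pQ _] := and3P sylQ.
have sQG := subset_trans sQC (subsetIl _ _).
have [y Gy sQyP] := Sylow_Jsub sylP sQG pQ.
have le_eps : logn p #|P : Q :^ y| <= eps p G.
  apply: leq_trans (leq_bigmax_cond x Gx).
  (* Equality holds here: [P] and [Q] carry the p-parts of [#|G|] and [#|'C_G[x]|]. *)
  rewrite /eps_elt -index_cent1 -!divgS ?subsetIl // !logn_div ?cardSg ?subsetIl //.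
  by rewrite cardJg (card_Hall sylP) (card_Hall sylQ) !logn_part.
have sKQ : K \subset Q :^ y := Phi_iter_sub_logn_index pP sQyP le_eps.
(* [x ^ y] centralizes [Q :^ y], hence [K]. *)
rewrite -[x](conjgK y); apply: memJ_class_support; rewrite ?groupV //.
rewrite inE groupJ //= -sub_cent1 cent1J (subset_trans sKQ) // conjSg.
exact: subset_trans sQC (subsetIr _ _).
Qed.

(** In a p-group, commutators and p-th powers generate the Frattini subgroup, so it commutes with
    quotients. *)
Lemma quotient_Phi_iter (gT : finGroupType) (p m : nat) (P H : {group gT}) :
  p.-group P -> P \subset 'N(H) ->
  Phi_iter m (P / H) = Phi_iter m P / H :> {set _}.
Proof.
move=> pP nHP; elim: m => //= m IHm.
have sKP := Phi_iter_sub m P.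
by rewrite IHm (quotient_Phi (pgroupS sKP pP) (subset_trans sKP nHP)).
Qed.

Theorem theorem1p1 (gT : finGroupType) (G : {group gT}) (p : nat)
    (p_pr : prime p) :
  phi_len p (G / 'Z(G)) <= eps p G.
Proof.
have [P sylP] := Sylow_exists p G; have [sPG pP _] := and3P sylP.
have nZP : P \subset 'N('Z(G)) := subset_trans sPG (normal_norm (center_normal G)).
rewrite (phi_lenP _ (quotient_pHall nZP sylP)).
apply/eqP; rewrite (quotient_Phi_iter _ pP nZP).
exact: quotientS1 (Phi_iter_eps_central sylP).
Qed.
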